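(* Cubical polytopes are not reconstructible from their dual graph and dimension. That is, there exist a positive integer $d$, a cubical $d$-polytope $P$ and a $d$-polytope $P'$ such that the dual graphs of $P$ and $P'$ are isomorphic, but $P$ and $P'$ are not combinatorially equivalent.
   Context: A $d$-polytope is the convex hull of finitely many points (in some $\mathbb{R}^N$) whose affine hull is $d$-dimensional. Two polytopes are combinatorially equivalent if there is an inclusion-preserving bijection between their face lattices. A facet is a face of codimension one and a ridge is a face of codimension two. The dual graph of a polytope is the graph whose nodes are the facets, two facets being adjacent if and only if they share a ridge. A polytope is cubical if each of its facets is (combinatorially equivalent to) a cube. A $d$-polytope is reconstructible from its dual graph and dimension if, up to combinatorial equivalence, it is the only $d$-polytope (among all $d$-polytopes) whose dual graph is isomorphic to the given graph, so that the graph and $d$ determine its face lattice. *)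

(* Defs.v *)
From HB Require Import structures.
From mathcomp Require Import all_boot all_order all_algebra.
From mathcomp Require Import all_classical all_reals.

Set Implicit Arguments.
Unset Strict Implicit.
Unset Printing Implicit Defensive.

Import Order.TTheory GRing.Theory Num.Theory.
Local Open Scope classical_set_scope.
Local Open Scope ring_scope.

Section Polytopes.
Context {R : realFieldType}.

Definition conv_hull {N : nat} (A : set 'rV[R]_N) : set 'rV[R]_N :=
  [set x | exists (n : nat) (p : 'I_n -> 'rV[R]_N) (a : 'I_n -> R),
     [/\ forall i, A (p i), forall i, 0 <= a i,
         \sum_(i < n) a i = 1 & x = \sum_(i < n) a i *: p i]].

Definition aff_hull {N : nat} (A : set 'rV[R]_N) : set 'rV[R]_N :=
  [set x | exists (n : nat) (p : 'I_n -> 'rV[R]_N) (a : 'I_n -> R),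
     [/\ forall i, A (p i), \sum_(i < n) a i = 1
       & x = \sum_(i < n) a i *: p i]].

(* The dimension of the affine hull; the empty set has dimension -1, so that
   the empty face is a ridge of a segment. *)
Definition has_dim {N : nat} (A : set 'rV[R]_N) (k : int) : Prop :=
  (A = set0 /\ k = -1) \/
  (exists (x0 : 'rV[R]_N) (U : {vspace 'rV[R]_N}),
     aff_hull A = [set x | x - x0 \in U] /\ k = (\dim U)%:Z).

Definition is_polytope {N : nat} (P : set 'rV[R]_N) : Prop :=
  exists s : seq 'rV[R]_N, P = conv_hull [set` s].

Definition is_dpolytope {N : nat} (d : nat) (P : set 'rV[R]_N) : Prop :=
  is_polytope P /\ has_dim P d%:Z.

Definition dot {N : nat} (a x : 'rV[R]_N) : R := \sum_(i < N) a 0 i * x 0 i.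

(* Intersections of P with the zero set of a valid affine inequality. Taking
   a = 0 makes P (with b = 0) and the empty set (with b = 1) faces, so this is
   the underlying set of the whole face lattice. *)
Definition faces {N : nat} (P : set 'rV[R]_N) : set (set 'rV[R]_N) :=
  [set F | exists (a : 'rV[R]_N) (b : R),
     (forall x, P x -> dot a x <= b) /\ F = P `&` [set x | dot a x = b]].

Definition faces_codim {N : nat} (c : nat) (P : set 'rV[R]_N) :
    set (set 'rV[R]_N) :=
  [set F | faces P F /\
     exists k : int, has_dim P k /\ has_dim F (k - c%:Z)].

Definition facets {N : nat} (P : set 'rV[R]_N) := faces_codim 1 P.
Definition ridges {N : nat} (P : set 'rV[R]_N) := faces_codim 2 P.

Definition comb_equiv {N N' : nat}
    (P : set 'rV[R]_N) (P' : set 'rV[R]_N') : Prop :=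
  exists f : set 'rV[R]_N -> set 'rV[R]_N',
    set_bij (faces P) (faces P') f /\
    (forall F G, faces P F -> faces P G -> (F `<=` G <-> f F `<=` f G)).

Definition dual_adj {N : nat} (P F G : set 'rV[R]_N) : Prop :=
  F <> G /\ exists2 E, ridges P E & E `<=` F /\ E `<=` G.

Definition dual_graph_iso {N N' : nat}
    (P : set 'rV[R]_N) (P' : set 'rV[R]_N') : Prop :=
  exists f : set 'rV[R]_N -> set 'rV[R]_N',
    set_bij (facets P) (facets P') f /\
    (forall F G, facets P F -> facets P G ->
       (dual_adj P F G <-> dual_adj P' (f F) (f G))).

Definition unit_cube (k : nat) : set 'rV[R]_k :=
  [set x | forall i, 0 <= x 0 i <= 1].

Definition is_cube {N : nat} (Q : set 'rV[R]_N) : Prop :=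
  exists k : nat, comb_equiv Q (@unit_cube k).

Definition is_cubical {N : nat} (P : set 'rV[R]_N) : Prop :=
  forall F, facets P F -> is_cube F.

End Polytopes.

(* Main.v *)
(* P is the 4-cube and P' is [0 <= x_1, x_2, x_3 <= 1, 0 <= x_0 <= x_1 + x_2 + x_3],
   the cube with one edge contracted to a vertex. The contraction destroys no
   ridge, since an edge has codimension 3, and only makes the facets x_0 = 0 and
   x_0 = x_1 + x_2 + x_3 meet in a vertex; so both dual graphs are K_{2,2,2,2}.
   But the contracted vertex lies on five facets, whereas no vertex of the cube
   lies on more than four. *)
Require Import Defs.
From HB Require Import structures.
From mathcomp Require Import all_boot all_order all_algebra.
From mathcomp Require Import all_classical all_reals.
From mathcomp Require Import ring lra.

Set Implicit Arguments.
Unset Strict Implicit.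
Unset Printing Implicit Defensive.

Import Order.TTheory GRing.Theory Num.Theory.
Local Open Scope classical_set_scope.
Local Open Scope ring_scope.

(** * Affine hulls, dimension and linear hyperplanes *)

Section Dimension.
Context {R : realFieldType} {N : nat}.
Implicit Types (A B P F G : set 'rV[R]_N) (a x u : 'rV[R]_N) (U V : {vspace 'rV[R]_N}).

Lemma dotD a x y : dot a (x + y) = dot a x + dot a y.
Proof. by rewrite /dot -big_split; apply: eq_bigr => i _; rewrite mxE mulrDr. Qed.

Lemma dotZ a c x : dot a (c *: x) = c * dot a x.
Proof. by rewrite /dot mulr_sumr; apply: eq_bigr => i _; rewrite mxE mulrCA. Qed.

Lemma dotDl a a' x : dot (a + a') x = dot a x + dot a' x.
Proof. by rewrite /dot -big_split; apply: eq_bigr => i _; rewrite mxE mulrDl. Qed.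

Lemma dot0l x : dot 0 x = 0.
Proof. by rewrite /dot big1 // => i _; rewrite mxE mul0r. Qed.

Lemma dot0 a : dot a 0 = 0.
Proof. by rewrite -(scale0r 0) dotZ mul0r. Qed.

Lemma dotN a x : dot a (- x) = - dot a x.
Proof. by rewrite -scaleN1r dotZ mulN1r. Qed.

Lemma dot_sum (I : finType) a (c : I -> R) (p : I -> 'rV[R]_N) :
  dot a (\sum_i c i *: p i) = \sum_i c i * dot a (p i).
Proof.
rewrite (big_morph (dot a) (dotD a) (dot0 a)).
by apply: eq_bigr => i _; rewrite dotZ.
Qed.

Lemma sub_aff_hull A : A `<=` aff_hull A.
Proof.
move=> x Ax; exists 1%N, (fun=> x), (fun=> 1).
by split=> //; rewrite big_ord1 ?scale1r.
Qed.

Lemma aff_hullS A B : A `<=` B -> aff_hull A `<=` aff_hull B.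
Proof. by move=> AB x [n [p [c [Ap c1 ->]]]]; exists n, p, c; split=> // i; apply: AB. Qed.

Lemma aff_hull_hyperplane A a (b : R) :
  (forall x, A x -> dot a x = b) -> forall x, aff_hull A x -> dot a x = b.
Proof.
move=> Ab x [n [p [c [Ap c1 ->]]]]; rewrite dot_sum.
under eq_bigr => i _ do rewrite (Ab _ (Ap i)).
by rewrite -mulr_suml c1 mul1r.
Qed.

Lemma aff_hull0 : aff_hull (set0 : set 'rV[R]_N) = set0.
Proof.
apply/seteqP; split=> // x [[|n] [p [c [Ap c1 _]]]]; last by have := Ap ord0.
by move: c1; rewrite big_ord0 => /eqP; rewrite eq_sym oner_eq0.
Qed.

Lemma aff_flatS x0 x1 U V :
  [set x | x - x0 \in U] `<=` [set x | x - x1 \in V] -> (U <= V)%VS.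
Proof.
move=> UV; have V0 : x0 - x1 \in V by apply: UV; rewrite /= subrr mem0v.
apply/subvP => u uU; have : (u + x0) - x1 \in V by apply: UV; rewrite /= addrK.
by rewrite -addrA => h; rewrite -(addrK (x0 - x1) u) memvB.
Qed.

(** Moving the base point of the flat to a given point of [A] lets nested sets share a base point,
    so that only their direction spaces need comparing. *)
Lemma has_dimP A k x : A x -> has_dim A k ->
  exists2 U : {vspace 'rV[R]_N}, aff_hull A = [set y | y - x \in U] & k = (\dim U)%:Z.
Proof.
move=> Ax [[A0 _]|[x0 [U [AU ->]]]]; first by rewrite A0 in Ax.
exists U => //; rewrite AU.
have xU : x - x0 \in U by have := sub_aff_hull Ax; rewrite AU.
apply/seteqP; split=> y /= yU.
  by have -> : y - x = (y - x0) - (x - x0); [rewrite opprB addrA subrK|rewrite memvB].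
by have -> : y - x0 = (y - x) + (x - x0); [rewrite addrA subrK|rewrite memvD].
Qed.

Lemma has_dim0 k : has_dim (set0 : set 'rV[R]_N) k -> k = -1.
Proof.
move=> [[_ ->] //|[x0 [U [AU _]]]].
suff : (set0 : set 'rV[R]_N) x0 by [].
by rewrite -aff_hull0 AU /= subrr mem0v.
Qed.

Lemma has_dim_le A B k l : A `<=` B -> has_dim A k -> has_dim B l -> k <= l.
Proof.
move=> AB dA dB; have [A0|/set0P[x Ax]] := eqVneq A set0.
  rewrite A0 in dA; rewrite (has_dim0 dA).
  by case: dB => [[_ ->]|[? [? [_ ->]]]].
have [U AU ->] := has_dimP Ax dA; have [V BV ->] := has_dimP (AB _ Ax) dB.
by rewrite lez_nat dimvS // (@aff_flatS x x) // -AU -BV; apply: aff_hullS.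
Qed.

Lemma has_dim_inj A k l : has_dim A k -> has_dim A l -> k = l.
Proof. by move=> dk dl; apply/le_anti; rewrite !(@has_dim_le A A). Qed.

(** With a common base point, nested direction spaces of equal dimension coincide. *)
Lemma has_dim_eq_aff A B k : A `<=` B -> has_dim A k -> has_dim B k ->
  aff_hull A = aff_hull B.
Proof.
move=> AB dA dB; have [A0|/set0P[x Ax]] := eqVneq A set0.
  rewrite A0 in dA *; have k1 := has_dim0 dA.
  by case: dB => [[-> _] //|[? [? [_ kU]]]]; rewrite kU in k1.
have [U AU kU] := has_dimP Ax dA; have [V BV kV] := has_dimP (AB _ Ax) dB.
rewrite AU BV; suff /eqP-> : U == V by [].
rewrite eqEdim (@aff_flatS x x) -?AU -?BV; last exact: aff_hullS.
by rewrite /= -lez_nat -kU -kV.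
Qed.

(* A point of [x0 + U] is an affine combination of [x0] and of a point of [A]
   close to [x0] in the same direction. *)
Lemma has_dim_relint A x0 U : A x0 -> (forall x, A x -> x - x0 \in U) ->
  (forall u, u \in U -> exists2 e, 0 < e & A (x0 + e *: u)) ->
  has_dim A (\dim U)%:Z.
Proof.
move=> Ax0 AU UA; right; exists x0, U; split=> //; apply/seteqP; split=> x.
  move=> [n [p [c [Ap c1 ->]]]] /=.
  rewrite -[x0]scale1r -c1 scaler_suml -sumrB memv_suml // => i _.
  by rewrite -scalerBr memvZ ?AU.
move=> /= /UA[e e0 Ae].
exists 2, (tnth [tuple x0; x0 + e *: (x - x0)]), (tnth [tuple 1 - e^-1; e^-1]).
split; first by case=> -[|[|]].
  by rewrite !big_ord_recl big_ord0 /= addr0 subrK.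
rewrite !big_ord_recl big_ord0 /= !(tnth_nth 0) /= addr0 scalerDr scalerA mulVf ?gt_eqF //.
by rewrite scale1r addrA -scalerDl subrK scale1r addrC subrK.
Qed.

Lemma has_dim_sub1 A p k : A `<=` [set p] -> has_dim A k -> k <= 0.
Proof.
move=> Ap dA.
have : has_dim [set p] (\dim (0%VS : {vspace 'rV[R]_N}))%:Z.
  apply: (@has_dim_relint _ p) => // [x ->|u]; first by rewrite subrr mem0v.
  by rewrite memv0 => /eqP ->; exists 1 => //; rewrite scaler0 addr0.
by rewrite dimv0; apply: has_dim_le Ap dA.
Qed.

Let dot_linear a : linear (dot a : 'rV[R]_N -> R^o).
Proof. by move=> c x y; rewrite dotD dotZ. Qed.

Let dot_lin a := GRing.isLinear.Build R 'rV[R]_N R^o *:%R (dot a) (dot_linear a).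
HB.instance Definition _ a := dot_lin a.

Definition hyperv a : {vspace 'rV[R]_N} := lker (linfun (dot a : 'rV[R]_N -> R^o)).

Lemma mem_hyperv a u : (u \in hyperv a) = (dot a u == 0).
Proof. by rewrite memv_ker lfunE. Qed.

(** Rank-nullity for [dot a] restricted to [U]: the image lies in a line, and [u] keeps it from
    vanishing. *)
Lemma dim_hyperv U a u : u \in U -> dot a u != 0 ->
  (\dim (U :&: hyperv a)).+1 = \dim U.
Proof.
move=> uU au; set f := linfun (dot a : 'rV[R]_N -> R^o).
rewrite -(limg_ker_dim f U) -[LHS]addn1; congr addn; apply/eqP.
rewrite eqn_leq; apply/andP; split.
  rewrite lt0n dimv_eq0; apply: contra au => /eqP h.
  by have := memv_img f uU; rewrite h memv0 lfunE.
by rewrite (leq_trans (dimvS (subvf _))) // dimvf /dim.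
Qed.

End Dimension.

Lemma dim_rV (R : realFieldType) (N : nat) : (\dim {:'rV[R]_N})%:Z = N%:Z.
Proof. by rewrite dimvf /dim /= mul1n. Qed.

(** * Facets and ridges of solution sets of linear inequalities *)

Section HPolyhedron.
Context {R : realFieldType} {N : nat} {J : finType}.
Variables (a : J -> 'rV[R]_N) (b : J -> R).
Implicit Types (F : set 'rV[R]_N) (x u v : 'rV[R]_N).

Definition hpoly : set 'rV[R]_N := [set x | forall j, dot (a j) x <= b j].

Definition hface (j : J) : set 'rV[R]_N := hpoly `&` [set x | dot (a j) x = b j].

Lemma faces_hface j : faces hpoly (hface j).
Proof. by exists (a j), (b j); split=> // x. Qed.

Lemma hpoly_step x u : hpoly x -> (forall j, dot (a j) x = b j -> dot (a j) u <= 0) ->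
  exists2 e, 0 < e & hpoly (x + e *: u).
Proof.
(* A step [e] respects a non-tight inequality [j] as soon as [e * r j <= 1], and [1 + \sum_j r j]
   dominates every [r j]. At a tight [j] the division by zero gives the harmless value 0, and the
   sign hypothesis on [u] takes over. *)
move=> Px tight; pose r j := `|dot (a j) u| / (b j - dot (a j) x).
have r0 j : 0 <= r j by rewrite divr_ge0 // subr_ge0.
have s0 : 0 < 1 + \sum_j r j by rewrite ltr_pwDl // sumr_ge0.
exists (1 + \sum_j r j)^-1 => [|j]; first by rewrite invr_gt0.
rewrite dotD dotZ -lerBrDl; have [xb|xb] := eqVneq (dot (a j) x) (b j).
  by rewrite xb subrr mulr_ge0_le0 ?tight // invr_ge0 ltW.
have gap : 0 < b j - dot (a j) x by rewrite subr_gt0 lt_neqAle xb Px.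
rewrite ler_pdivrMl // (le_trans (ler_norm _)) // -ler_pdivrMr //.
by rewrite -/(r j) (bigD1 j) //= addrCA lerDl addr_ge0 // sumr_ge0.
Qed.

(* If no facet inequality is tight on all of [F], averaging gives a point of
   [F] at which none is tight, i.e. an interior point of the polyhedron. *)
Lemma face_sub_hface F : (0 < #|J|)%N -> faces hpoly F -> F <> hpoly ->
  exists j, F `<=` hface j.
Proof.
move=> J0 [c [d [valid FE]]] FP; have [//|noj] := pselect (exists j, F `<=` hface j).
case: FP; have FsubP : F `<=` hpoly by rewrite FE => x [].
have /choice[p pP] : forall j, exists x, F x /\ dot (a j) x < b j.
  move=> j; apply: contrapT => nox; apply: noj; exists j => x Fx.
  split; first exact: FsubP.
  apply/eqP; apply: contrapT => /negP ne; apply: nox; exists x; split=> //.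
  by rewrite lt_neqAle ne (FsubP _ Fx).
pose m : R := #|J|%:R; have m0 : 0 < m by rewrite ltr0n.
pose q := \sum_j m^-1 *: p j.
have avg (t : R) : t = \sum_(j : J) m^-1 * t.
  by rewrite sumr_const -mulr_natl mulrA mulfV ?mul1r // gt_eqF.
have qlt k : dot (a k) q < b k.
  rewrite dot_sum [ltRHS]avg (bigD1 k) //= [ltRHS](bigD1 k) //= ltr_leD //.
    by rewrite ltr_pM2l ?invr_gt0 //; case: (pP k).
  apply: ler_sum => j _; rewrite ler_pM2l ?invr_gt0 //; apply: FsubP.
  by case: (pP j).
have qF : dot c q = d.
  rewrite dot_sum [RHS]avg; apply: eq_bigr => j _; congr (_ * _).
  by case: (pP j) => + _; rewrite FE => -[].
apply/seteqP; split=> // y Py; rewrite FE; split=> //=.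
(* From the interior point [q] one can move slightly away from [y]. Validity of the face inequality
   there forces [d <= dot c y]. *)
have [|j|e e0 /valid] := @hpoly_step q (q - y).
- by move=> j; rewrite ltW.
- by move=> qj; have := qlt j; rewrite qj ltxx.
rewrite dotD qF gerDl dotZ pmulr_rle0 // dotD dotN qF subr_le0 => dy.
by apply/le_anti; rewrite dy valid.
Qed.

Lemma has_dim_hpoly x : (forall j, dot (a j) x < b j) -> has_dim hpoly N%:Z.
Proof.
move=> xlt; rewrite -(dim_rV R N).
apply: (@has_dim_relint _ _ _ x) => [j|y _|u _]; rewrite ?memvf ?ltW //.
by apply: hpoly_step => [j|j xj]; [rewrite ltW|have := xlt j; rewrite xj ltxx].
Qed.

(** Only inequality [j] is tight at [x], so short moves from [x] along the kernel of [a j] stay in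
    the face; [u] shows that this kernel has codimension one. *)
Lemma has_dim_hface j x u : dot (a j) x = b j ->
  (forall k, k != j -> dot (a k) x < b k) -> dot (a j) u != 0 ->
  has_dim (hface j) (N%:Z - 1%:Z).
Proof.
move=> xj xlt ju.
have Px : hpoly x by move=> k; have [->|/xlt/ltW//] := eqVneq k j; rewrite xj.
have <- : (\dim (fullv :&: hyperv (a j)))%:Z = N%:Z - 1%:Z.
  by rewrite -(dim_rV R N) -(dim_hyperv (memvf u) ju) subzn // subn1.
apply: (@has_dim_relint _ _ _ x) => // [y [_ /= yj]|v].
  by rewrite memv_cap memvf mem_hyperv dotD dotN yj xj subrr eqxx.
rewrite memv_cap mem_hyperv => /andP[_ /eqP vj].
have [//|k|e e0 Pe] := @hpoly_step x v.
  by have [->|/xlt + xk] := eqVneq k j; rewrite ?vj // xk ltxx.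
by exists e => //; split=> //=; rewrite dotD dotZ vj mulr0 addr0.
Qed.

(** The same argument with two tight inequalities: [u] and [v], in triangular position, certify that
    [a i] and [a j] are linearly independent. *)
Lemma has_dim_hface2 i j x u v : dot (a i) x = b i -> dot (a j) x = b j ->
  (forall k, k != i -> k != j -> dot (a k) x < b k) ->
  dot (a i) u != 0 -> dot (a i) v = 0 -> dot (a j) v != 0 ->
  has_dim (hface i `&` hface j) (N%:Z - 2%:Z).
Proof.
move=> xi xj xlt iu iv jv.
have Px : hpoly x.
  move=> k; have [->|ki] := eqVneq k i; first by rewrite xi.
  by have [->|/xlt-/(_ ki)/ltW//] := eqVneq k j; rewrite xj.
have <- : (\dim (fullv :&: hyperv (a i) :&: hyperv (a j)))%:Z = N%:Z - 2%:Z.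
  rewrite -(dim_rV R N) -(dim_hyperv (memvf u) iu).
  rewrite -(dim_hyperv (U := (fullv :&: hyperv (a i))%VS) (u := v) _ jv).
    by rewrite subzn // subn2.
  by rewrite memv_cap memvf mem_hyperv iv eqxx.
apply: (@has_dim_relint _ _ _ x) => // [y [[_ /= yi] [_ /= yj]]|w].
  by rewrite !memv_cap memvf !mem_hyperv !dotD !dotN yi yj xi xj !subrr eqxx.
rewrite !memv_cap !mem_hyperv => /andP[/andP[_ /eqP wi] /eqP wj].
have [//|k|e e0 Pe] := @hpoly_step x w.
  have [->|ki] := eqVneq k i; first by rewrite wi.
  by have [->|/xlt-/(_ ki) + xk] := eqVneq k j; rewrite ?wj // xk ltxx.
by exists e => //; split; split=> //=; rewrite dotD dotZ ?wi ?wj mulr0 addr0.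
Qed.

(** A facet is a proper face, hence inside some [hface j] of the same dimension. Both then have the
    same affine hull, on which the equation cutting out the facet still holds, so [hface j] has no
    further point. *)
Lemma facets_hpoly : (0 < #|J|)%N -> has_dim hpoly N%:Z ->
  (forall j, has_dim (hface j) (N%:Z - 1%:Z)) ->
  facets hpoly = [set hface j | j in setT].
Proof.
move=> J0 dP dF; apply/seteqP; split=> [F [fF [k [dk dFk]]]|_ [j _ <-]]; last first.
  by split; [exact: faces_hface|exists N%:Z].
have kN := has_dim_inj dk dP; rewrite {k dk}kN in dFk.
have [FP|j Fj] := face_sub_hface J0 fF.
  have := has_dim_inj dP; rewrite -FP => /(_ _ dFk)/eqP.
  by rewrite eq_sym subr_eq addrC -subr_eq subrr.
exists j => //; apply/seteqP; split=> // x xj.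
have := sub_aff_hull xj; rewrite -(has_dim_eq_aff Fj dFk (dF j)).
case: fF => c [d [_ FE]] xF; rewrite FE; split; first by case: xj.
by apply: aff_hull_hyperplane xF; rewrite FE => y [].
Qed.

(** Add the two valid inequalities: equality in the sum forces equality in both. *)
Lemma faces_setI P F G : faces P F -> faces P G -> faces (P : set 'rV[R]_N) (F `&` G).
Proof.
move=> [c [d [cP ->]]] [c' [d' [cP' ->]]]; exists (c + c'), (d + d'); split=> [x Px|].
  by rewrite dotDl lerD ?cP ?cP'.
apply/seteqP; split=> x /= [].
  by move=> [Px xd] [_ xd']; rewrite dotDl xd xd'.
move=> Px; rewrite dotDl => e; have h := cP _ Px; have h' := cP' _ Px.
by split; split=> //; lra.
Qed.

Lemma dual_adj_hpoly i j : has_dim hpoly N%:Z -> hface i <> hface j ->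
  has_dim (hface i `&` hface j) (N%:Z - 2%:Z) -> dual_adj hpoly (hface i) (hface j).
Proof.
move=> dP ne dE; split=> //; exists (hface i `&` hface j).
  by split; [apply: faces_setI; exact: faces_hface|exists N%:Z].
by split=> x [].
Qed.

(** A common ridge would have dimension [N - 2 > 0], too large for a subset of a point. *)
Lemma not_dual_adj_hpoly i j p : (2 < N)%N -> has_dim hpoly N%:Z ->
  hface i `&` hface j `<=` [set p] -> ~ dual_adj hpoly (hface i) (hface j).
Proof.
move=> N2 dP sub [_ [E [_ [k [dk dE]]] [Ei Ej]]].
have kN := has_dim_inj dk dP; rewrite kN in dE.
have : E `<=` [set p] by move=> x Ex; apply: sub; split; [apply: Ei|apply: Ej].
by move=> /has_dim_sub1/(_ dE); rewrite subr_le0 lez_nat leqNgt N2.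
Qed.

End HPolyhedron.

(** * Criteria for isomorphism and equivalence, and convex combinations *)

Section Combinatorics.
Context {R : realFieldType}.

Lemma dual_graph_iso_indexed (J : Type) (N N' : nat) (P : set 'rV[R]_N) (P' : set 'rV[R]_N')
    (F : J -> set 'rV[R]_N) (F' : J -> set 'rV[R]_N') :
  facets P = range F -> facets P' = range F' -> injective F -> injective F' ->
  (forall i j, dual_adj P (F i) (F j) <-> dual_adj P' (F' i) (F' j)) ->
  dual_graph_iso P P'.
Proof.
move=> PF PF' Finj Finj' adj.
(* The map must be defined on all sets: injectivity of [F] makes it well defined on facets, and
   [set0] is a junk value elsewhere. *)
have /choice[f fE] : forall X, exists Y, forall j, X = F j -> Y = F' j.
  move=> X; have [[i ->]|noi] := pselect (exists i, X = F i).
    by exists (F' i) => j /Finj ->.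
  by exists set0 => j Xj; case: noi; exists j.
have {}fE j : f (F j) = F' j by apply: fE.
exists f; rewrite PF PF'; split; last first.
  by move=> _ _ [i _ <-] [j _ <-]; rewrite !fE.
split=> [_ [j _ <-]|X Y|_ [j _ <-]]; first by rewrite fE; exists j.
  rewrite !inE => -[i _ <-] [j _ <-]; rewrite !fE => /Finj' -> //.
by exists (F j); rewrite ?fE //; exists j.
Qed.

(* The last two hypotheses say that [phi] and [psi] are affine. *)
Lemma comb_equiv_affine (N N' : nat) (P : set 'rV[R]_N) (P' : set 'rV[R]_N')
    (phi : 'rV[R]_N -> 'rV[R]_N') (psi : 'rV[R]_N' -> 'rV[R]_N) :
  (forall x, P x -> P' (phi x)) -> (forall y, P' y -> P (psi y)) ->
  (forall x, P x -> psi (phi x) = x) -> (forall y, P' y -> phi (psi y) = y) ->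
  (forall a, exists a' c, forall x, dot a (phi x) = dot a' x + c) ->
  (forall a, exists a' c, forall y, dot a (psi y) = dot a' y + c) ->
  comb_equiv P P'.
Proof.
move=> phiP psiP psiK phiK phi_aff psi_aff.
(* The image of a face is cut out by its functional pulled back along the affine inverse [h].
   General [Q] and [Q'] allow use in both directions. *)
have face_image (M M' : nat) (Q : set 'rV[R]_M) (Q' : set 'rV[R]_M')
    (g : 'rV[R]_M -> 'rV[R]_M') (h : 'rV[R]_M' -> 'rV[R]_M) F :
    (forall x, Q x -> Q' (g x)) -> (forall y, Q' y -> Q (h y)) ->
    (forall x, Q x -> h (g x) = x) -> (forall y, Q' y -> g (h y) = y) ->
    (forall a, exists a' c, forall y, dot a (h y) = dot a' y + c) ->
    faces Q F -> faces Q' (g @` F).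
  move=> gQ hQ hK gK aff [a [b [Qb ->]]]; have [a' [c ac]] := aff a.
  exists a', (b - c); split=> [y /hQ/Qb|]; first by rewrite ac lerBrDr.
  apply/seteqP; split=> [_ [x [Qx /= xb] <-]|y [Qy /= yb]].
    by split=> /=; [exact: gQ|rewrite -xb -{2}[x]hK // ac addrK].
  by exists (h y); [split; [exact: hQ|rewrite /= ac yb subrK]|exact: gK].
have fsub (M : nat) (Q F : set 'rV[R]_M) : faces Q F -> F `<=` Q.
  by move=> [a [b [_ ->]]] x [].
have phi_mem F x : faces P F -> P x -> (phi @` F) (phi x) -> F x.
  move=> FP Px [y Fy /(congr1 psi)].
  by rewrite (psiK _ Px) (psiK _ (fsub _ _ _ FP _ Fy)) => <-.
exists (fun F => phi @` F); split; first split.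
- by move=> F; apply: (face_image _ _ _ _ phi psi).
- move=> F G; rewrite !inE => FP GP FG; apply/seteqP; split=> x Hx.
    by apply: phi_mem => //; [exact: fsub FP _ Hx|rewrite -FG; exists x].
  by apply: phi_mem => //; [exact: fsub GP _ Hx|rewrite FG; exists x].
- move=> F' F'P; exists (psi @` F'); first exact: (face_image _ _ P' P psi phi).
  apply/seteqP; split=> [_ [_ [y Fy <-] <-]|y Fy].
    by rewrite phiK //; apply: fsub F'P _ Fy.
  by exists (psi y); [exists y|apply: phiK; apply: fsub F'P _ Fy].
- move=> F G FP GP; split=> [FG|FG x Fx]; first exact: image_subset.
  by apply: phi_mem => //; [exact: fsub FP _ Fx|apply: FG; exists x].
Qed.

Lemma conv_hull_fin (N : nat) (A : set 'rV[R]_N) (I : finType) (p : I -> 'rV[R]_N)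
    (c : I -> R) :
  (forall i, A (p i)) -> (forall i, 0 <= c i) -> \sum_i c i = 1 ->
  conv_hull A (\sum_i c i *: p i).
Proof.
move=> Ap c0 c1; exists #|I|, (p \o enum_val), (c \o enum_val).
split=> [i|i||] /=; [exact: Ap|exact: c0|..].
  by rewrite -c1 -(big_enum_val c); apply: eq_bigl.
by rewrite -(big_enum_val (fun i => c i *: p i)); apply: eq_bigl.
Qed.

Lemma conv_hull_sub_hpoly (N : nat) (J : finType) (a : J -> 'rV[R]_N) (b : J -> R)
    (A : set 'rV[R]_N) : A `<=` hpoly a b -> conv_hull A `<=` hpoly a b.
Proof.
move=> AP x [n [p [c [Ap c0 c1 ->]]]] j; rewrite dot_sum.
rewrite -[b j]mul1r -c1 mulr_suml ler_sum // => i _.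
by rewrite ler_wpM2l //; apply: AP.
Qed.

(* The mean of a product of independent Bernoulli variables of parameters [t k]. *)
Lemma sum_bernoulli_weights (I : finType) (t : I -> R) (A : {set I}) :
  \sum_(e : {ffun I -> bool}) (\prod_k (if e k then t k else 1 - t k)) *
     \prod_(k in A) (e k)%:R = \prod_(k in A) t k.
Proof.
rewrite [RHS]big_mkcond; transitivity (\prod_k \sum_(b : bool)
  (if b then t k else 1 - t k) * (if k \in A then b%:R else 1)).
  rewrite bigA_distr_bigA; apply: eq_bigr => e _.
  by rewrite big_split /= -big_mkcond.
apply: eq_bigr => k _; rewrite big_bool /=.
by case: ifP; rewrite ?mulr1 ?mulr0 ?addr0 // addrC subrK.
Qed.

End Combinatorics.

(** * A two-parameter family of deformed cubes *)

(* [(alpha, beta) = (1, 0)] gives the cube and [(0, 1)] the contracted cube. The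
   facet [(k, false)] is [x_k = 0] and [(k, true)] is the opposite one. *)
Section Slab.
Context {R : realFieldType} {n : nat}.
Variables (alpha beta : R).
Implicit Types (k : 'I_n.+1) (j : 'I_n.+1 * bool) (t : 'I_n.+1 -> R) (x : 'rV[R]_n.+1).

Definition slab_height t k : R :=
  if k == ord0 then alpha + beta * \sum_(l | l != ord0) t l else 1.

Definition slab_bound j : R := if j.2 then (if j.1 == ord0 then alpha else 1) else 0.

(** In the upper bound on [x_0], the sum of the other coordinates is moved into the normal vector,
    leaving [alpha] on the right. *)
Definition slab_normal j : 'rV[R]_n.+1 :=
  if j.2 then
    \row_l ((l == j.1)%:R - (if j.1 == ord0 then beta *+ (l != ord0) else 0))
  else \row_l (- (l == j.1)%:R).

Definition slab := hpoly slab_normal slab_bound.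
Definition slab_facet := hface slab_normal slab_bound.

Lemma dot_slab_normal j x : dot (slab_normal j) x =
  if j.2 then x 0 j.1 - (if j.1 == ord0 then beta * \sum_(l | l != ord0) x 0 l else 0)
  else - x 0 j.1.
Proof.
have pick k : \sum_l (l == k)%:R * x 0 l = x 0 k.
  rewrite (bigD1 k) //= eqxx mul1r big1 ?addr0 // => l /negPf ->.
  by rewrite mul0r.
case: j => k [] /=; rewrite /dot /slab_normal /=; last first.
  by rewrite -[in RHS](pick k) -sumrN; apply: eq_bigr => l _; rewrite mxE mulNr.
under eq_bigr => l _ do rewrite mxE mulrBl.
rewrite big_split /= pick sumrN; congr (_ - _); case: ifP => _; last first.
  by rewrite big1 // => l _; rewrite mul0r.
rewrite mulr_sumr [RHS]big_mkcond; apply: eq_bigr => l _.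
by case: (l != ord0); rewrite ?mulr1n // mulr0n mul0r.
Qed.

Definition slack j x : R :=
  if j.2 then slab_height (x 0) j.1 - x 0 j.1 else x 0 j.1.

Lemma slackE j x : slab_bound j - dot (slab_normal j) x = slack j x.
Proof.
rewrite dot_slab_normal /slab_bound /slack /slab_height.
by case: j => k [] /=; [case: ifP => _; ring|rewrite opprK add0r].
Qed.

Lemma slab_ltE j x : (dot (slab_normal j) x < slab_bound j) = (0 < slack j x).
Proof. by rewrite -slackE subr_gt0. Qed.

Lemma slab_eqE j x : dot (slab_normal j) x = slab_bound j <-> slack j x = 0.
Proof.
rewrite -slackE; split=> [->|/eqP]; first by rewrite subrr.
by rewrite subr_eq0 => /eqP.
Qed.

Lemma slabP x : slab x <-> forall k, 0 <= x 0 k <= slab_height (x 0) k.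
Proof.
have leE j : (dot (slab_normal j) x <= slab_bound j) = (0 <= slack j x).
  by rewrite -slackE subr_ge0.
split=> [Px k|Px [k c]].
  by have := Px (k, false); have := Px (k, true); rewrite !leE /slack subr_ge0 => -> ->.
by rewrite leE /slack; case: c; rewrite /= ?subr_ge0; case/andP: (Px k).
Qed.

(** A parametrisation by the unit cube: [t k] is the fraction of the admissible height used by
    coordinate [k]. Heights depend only on coordinates other than [ord0], and there the point agrees
    with [t]. *)
Definition slab_point t : 'rV[R]_n.+1 := \row_k (t k * slab_height t k).

Lemma slab_height_point t : slab_height (slab_point t 0) = slab_height t.
Proof.
apply/funext => k; rewrite /slab_height; case: ifP => // _; congr (_ + _ * _).
by apply: eq_bigr => l /negPf l0; rewrite mxE /slab_height l0 mulr1.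
Qed.

Lemma slack_point j t : slack j (slab_point t) =
  (if j.2 then 1 - t j.1 else t j.1) * slab_height t j.1.
Proof.
rewrite /slack slab_height_point mxE; case: j.2 => //.
by rewrite mulrBl mul1r.
Qed.

Hypotheses (alpha0 : 0 <= alpha) (beta0 : 0 <= beta).

Lemma slab_height_ge0 t k : (forall l, 0 <= t l) -> 0 <= slab_height t k.
Proof.
move=> t0; rewrite /slab_height; case: ifP => // _.
by rewrite addr_ge0 // mulr_ge0 // sumr_ge0.
Qed.

Lemma slab_point_mem t : (forall k, 0 <= t k <= 1) -> slab (slab_point t).
Proof.
move=> t01; apply/slabP => k; rewrite slab_height_point mxE.
have h0 : 0 <= slab_height t k by apply: slab_height_ge0 => l; case/andP: (t01 l).
by case/andP: (t01 k) => tk tk1; rewrite mulr_ge0 //= ler_piMl.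
Qed.

(* When the height vanishes so does [x_0], and the junk value [x / 0 = 0] is right. *)
Lemma slab_pointK x : slab x ->
  exists2 t, (forall k, 0 <= t k <= 1) & x = slab_point t.
Proof.
move=> /slabP Px; pose t k := x 0 k / slab_height (x 0) k.
have tk k : k != ord0 -> t k = x 0 k.
  by move=> /negPf k0; rewrite /t /slab_height k0 divr1.
have hE : slab_height t = slab_height (x 0).
  apply/funext => k; rewrite /slab_height; case: ifP => // _.
  by congr (_ + _ * _); apply: eq_bigr => l /tk.
exists t => [k|].
  case/andP: (Px k) => x0 xh; rewrite divr_ge0 ?(le_trans x0) //=.
  have [h0|h0] := eqVneq (slab_height (x 0) k) 0; first by rewrite /t h0 invr0 mulr0.
  by rewrite ler_pdivrMr ?mul1r // lt_neqAle eq_sym h0 (le_trans x0).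
apply/rowP => k; rewrite mxE hE /t.
have [h0|h0] := eqVneq (slab_height (x 0) k) 0; last by rewrite divfK.
by rewrite h0 mulr0; have := Px k; rewrite h0 => /le_anti.
Qed.

(** The coordinates of [slab_point t] have degree at most one in each [t k]. Hence [slab_point t] is
    the mean of [slab_point e] over independent Bernoulli variables [e k] of parameters [t k], a
    convex combination of images of cube vertices. *)
Lemma slab_polytope : is_polytope slab.
Proof.
exists [seq slab_point (fun k => (e k)%:R) | e : {ffun 'I_n.+1 -> bool}].
apply/seteqP; split=> x; last first.
  apply: conv_hull_sub_hpoly => {}x /= /mapP[e _ ->].
  by apply: slab_point_mem => k; case: (e k); rewrite lexx ler01.
move=> /slab_pointK[t t01 ->].
pose w (e : {ffun 'I_n.+1 -> bool}) := \prod_k (if e k then t k else 1 - t k).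
have mean (A : {set 'I_n.+1}) : \sum_e w e * \prod_(k in A) (e k)%:R = \prod_(k in A) t k.
  exact: sum_bernoulli_weights.
have mean1 k : \sum_e w e * (e k)%:R = t k.
  by rewrite -[RHS](big_set1 *%R) -mean; apply: eq_bigr => e _; rewrite big_set1.
have mean2 k l : k != l -> \sum_e w e * ((e k)%:R * (e l)%:R) = t k * t l.
  move=> kl; have := mean [set k; l]%SET; rewrite big_setU1 ?inE //= big_set1 => <-.
  by apply: eq_bigr => e _; rewrite big_setU1 ?inE //= big_set1.
have -> : slab_point t = \sum_e w e *: slab_point (fun k => (e k)%:R).
  apply/rowP => k; rewrite summxE mxE /slab_height.
  under [RHS]eq_bigr => e _ do rewrite !mxE /slab_height.
  case: eqP => [->|_]; last first.
    by under [RHS]eq_bigr => e _ do rewrite mulr1; rewrite mean1 mulr1.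
  transitivity (alpha * (\sum_e w e * (e ord0)%:R) +
    beta * \sum_(l | l != ord0) \sum_e w e * ((e ord0)%:R * (e l)%:R)).
    rewrite mean1 mulrDr mulrC mulrCA mulr_sumr; congr (_ + _ * _).
    by apply: eq_bigr => l l0; rewrite mean2 // eq_sym.
  rewrite exchange_big !mulr_sumr -big_split; apply: eq_bigr => e _ /=.
  rewrite -mulr_sumr -mulr_sumr; ring.
apply: conv_hull_fin => [e|e|] /=.
- by apply: map_f; rewrite mem_enum.
- by apply: prodr_ge0 => k _; case: ifP => _; case/andP: (t01 k); rewrite ?subr_ge0.
- have := mean finset.set0; rewrite big_set0 => <-.
  by apply: eq_bigr => e _; rewrite big_set0 mulr1.
Qed.


(** * Facets, ridges and dual graph of the family *)

Hypotheses (ab0 : 0 < alpha + beta) (n2 : (2 < n)%N).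

(* Up to [slab_point], the centre of the face of the unit cube on which the
   coordinates in the domain of [s] are prescribed. *)
Definition slab_center (s : 'I_n.+1 -> option bool) : 'rV[R]_n.+1 :=
  slab_point (fun k => if s k is Some c then c%:R else 2^-1).

Lemma slack_center0 s j : s j.1 = Some j.2 -> slack j (slab_center s) = 0.
Proof. by rewrite slack_point => ->; case: j.2; rewrite ?subrr mul0r. Qed.

(** The free coordinate [l] contributes one half to the sum in the height over [ord0], which is
    therefore positive even when [alpha = 0]. *)
Lemma slack_center_gt0 s j : (exists2 l, l != ord0 & s l = None) ->
  s j.1 != Some j.2 -> 0 < slack j (slab_center s).
Proof.
move=> [l l0 sl] sj; rewrite slack_point mulr_gt0 //.
  by case: (s j.1) sj => [[]|] /=; case: j.2 => //= _; lra.
rewrite /slab_height; case: ifP => // _; set S := (X in beta * X).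
have S0 : 0 < S.
  rewrite /S (bigD1 l) //= sl ltr_pwDl ?invr_gt0 ?sumr_ge0 // => k _.
  by case: (s k) => [c|]; rewrite ?ler0n ?invr_ge0.
have [a0|a0] := eqVneq alpha 0.
  by rewrite a0 add0r mulr_gt0 //; move: ab0; rewrite a0 add0r.
by rewrite ltr_pwDl ?mulr_ge0 ?(ltW S0) // lt_neqAle eq_sym a0.
Qed.

(** Taking [i = j] prescribes a single coordinate, so facets and ridges are handled alike. *)
Definition tight2 i j k : option bool :=
  if k == i.1 then Some i.2 else if k == j.1 then Some j.2 else None.

(** At most three coordinates are excluded, and [2 < n] provides at least four. *)
Lemma tight2_free i j : exists2 l, l != ord0 & tight2 i j l = None.
Proof.
have /subsetPn[l _] : ~~ ([set: 'I_n.+1]%SET \subset [:: ord0; i.1; j.1]).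
  apply/negP => /subset_leq_card; rewrite cardsT card_ord leqNgt.
  by rewrite (leq_ltn_trans (card_size _)).
rewrite !inE !negb_or => /and3P[l0 /negPf li /negPf lj].
by exists l; rewrite // /tight2 li lj.
Qed.

Lemma tight2_neq i j m : m != i -> m != j -> tight2 i j m.1 != Some m.2.
Proof.
case: m i j => k c [ki ci] [kj cj]; rewrite /tight2 !xpair_eqE /=.
have [_ /=|_ _] := eqVneq k ki; first by case: c ci => [] [].
by have [_ /=|_ _] := eqVneq k kj; case: c cj => [] [].
Qed.

Lemma dim_slab : has_dim slab n.+1%:Z.
Proof.
apply: (@has_dim_hpoly _ _ _ _ _ (slab_center (fun=> None))) => j.
rewrite slab_ltE slack_center_gt0 //.
by exists (lift ord0 (Ordinal (ltnW (ltnW n2)))).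
Qed.

Definition slab_dir k : 'rV[R]_n.+1 := delta_mx 0 k.

Lemma slab_dirE k l : slab_dir k 0 l = (l == k)%:R.
Proof. by rewrite mxE. Qed.

Lemma dot_slab_dir j : dot (slab_normal j) (slab_dir j.1) != 0.
Proof.
rewrite dot_slab_normal slab_dirE eqxx.
case: j => k [] /=; last by rewrite oppr_eq0 oner_eq0.
have [->|_] := eqVneq k ord0; last by rewrite subr0 oner_eq0.
by rewrite big1 ?mulr0 ?subr0 ?oner_eq0 // => l /negPf l0; rewrite slab_dirE l0.
Qed.

Lemma dim_slab_facet j : has_dim (slab_facet j) (n.+1%:Z - 1%:Z).
Proof.
apply: (has_dim_hface (x := slab_center (tight2 j j)) _ _ (dot_slab_dir j)).
  by apply/slab_eqE/slack_center0; rewrite /tight2 eqxx.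
move=> m mj; rewrite slab_ltE slack_center_gt0 ?tight2_neq //.
exact: tight2_free.
Qed.

Lemma dim_slab_ridge i j : i.1 != j.1 ->
  has_dim (slab_facet i `&` slab_facet j) (n.+1%:Z - 2%:Z).
Proof.
move=> ij.
(* A direction along facet [i] but transverse to facet [j]. If [i] is the upper facet over [ord0],
   increasing coordinate [j.1] raises the height at rate [beta], which the second term follows. *)
pose v := slab_dir j.1 + (if (i.1 == ord0) && i.2 then beta else 0) *: slab_dir ord0.
have vE l : v 0 l = (l == j.1)%:R +
    (if (i.1 == ord0) && i.2 then beta else 0) * (l == ord0)%:R.
  by rewrite !mxE.
have sumv : \sum_(l | l != ord0) v 0 l = (j.1 != ord0)%:R.
  rewrite big_mkcond (bigD1 j.1) //= big1 ?addr0; last first.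
    move=> l /negPf lj; case: ifP => // /negPf l0.
    by rewrite vE lj l0 mulr0 addr0.
  by case: eqP => // /eqP/negPf j0; rewrite vE eqxx j0 mulr0 addr0.
apply: (has_dim_hface2 (x := slab_center (tight2 i j)) (v := v) _ _ _ (dot_slab_dir i)).
- by apply/slab_eqE/slack_center0; rewrite /tight2 eqxx.
- apply/slab_eqE/slack_center0; rewrite /tight2 eqxx.
  by rewrite eq_sym (negPf ij).
- move=> m mi mj; rewrite slab_ltE slack_center_gt0 ?tight2_neq //.
  exact: tight2_free.
- rewrite dot_slab_normal vE sumv (negPf ij) add0r.
  case: eqP => [i0|/eqP/negPf i0] /=; last by case: i.2; rewrite /= ?mulr0 ?subrr ?oppr0.
  by move: ij; rewrite i0 eq_sym => ->; case: i.2; rewrite ?mulr1 ?mul0r ?subrr ?oppr0.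
- rewrite dot_slab_normal vE sumv eqxx.
  have [j0|j0] := eqVneq j.1 ord0.
    move: ij; rewrite j0 => /negPf ->; case: j.2 => /=;
    by rewrite ?mulr0 ?mul0r ?addr0 ?subr0 ?oppr_eq0 oner_eq0.
  by case: j.2; rewrite /= mulr0 addr0 ?subr0 ?oppr_eq0 oner_eq0.
Qed.

Lemma slab_facetP j x : slab_facet j x <-> slab x /\ slack j x = 0.
Proof. by split=> -[Px /slab_eqE]. Qed.

(** The centre of facet [i] has positive slack for every other facet. *)
Lemma slab_facet_inclusion i j : slab_facet i `<=` slab_facet j -> i = j.
Proof.
move=> sub; apply/eqP; apply: contrapT => /negP ij.
have ci : slack i (slab_center (tight2 i i)) = 0.
  by apply: slack_center0; rewrite /tight2 eqxx.
have cj m : m != i -> 0 < slack m (slab_center (tight2 i i)).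
  by move=> mi; rewrite slack_center_gt0 ?tight2_neq //; exact: tight2_free.
have /sub/slab_facetP[_ cj0] : slab_facet i (slab_center (tight2 i i)).
  apply/slab_facetP; split=> // m; rewrite -subr_ge0 slackE.
  by have [->|/cj/ltW//] := eqVneq m i; rewrite ci.
by have := cj j; rewrite eq_sym ij cj0 ltxx => /(_ isT).
Qed.

Lemma slab_facet_inj : injective slab_facet.
Proof. by move=> i j ij; apply: slab_facet_inclusion; rewrite ij. Qed.

(** Opposite facets meet only where the height vanishes. This is impossible over [k != ord0]; over
    [ord0] it forces [alpha = 0] and, as then [beta > 0], all coordinates to be 0. *)
Lemma slab_opposite_facets i j : i.1 = j.1 -> i != j ->
  slab_facet i `&` slab_facet j `<=` [set 0].
Proof.
wlog : i j / i.2 = false.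
  move=> W ij1 ij x [xi xj]; case ei: i.2; last exact: (W i j).
  apply: (W j i) => //; last by rewrite eq_sym.
  by case: i j ij1 ij ei {xi xj} => k c [l []] //= -> /[swap] ->; rewrite eqxx.
case: i j => k [] //= [_ []] /= _ <-; rewrite ?eqxx // => _ x.
move=> [/slab_facetP[/slabP Px xk] /slab_facetP[_]].
rewrite /slack /= in xk *; rewrite xk subr0 /slab_height; case: eqP => [k0|_]; last first.
  by move/eqP; rewrite oner_eq0.
have x0 l : 0 <= x 0 l by case/andP: (Px l).
have S0 : 0 <= \sum_(l | l != ord0) x 0 l by rewrite sumr_ge0.
move=> /eqP; rewrite paddr_eq0 ?mulr_ge0 // => /andP[/eqP a0].
move: ab0; rewrite a0 add0r => /gt_eqF b0; rewrite mulf_eq0 b0 /= psumr_eq0 // => /allP xl.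
apply/rowP => l; rewrite mxE; have [->|l0] := eqVneq l ord0; first by rewrite -k0.
by apply/eqP; have := xl l; rewrite l0; apply; rewrite mem_index_enum.
Qed.

Lemma facets_slab : facets slab = range slab_facet.
Proof.
apply: facets_hpoly; [|exact: dim_slab|exact: dim_slab_facet].
by apply/card_gt0P; exists (ord0, true).
Qed.

Lemma slab_proper_face F : faces slab F -> F <> slab -> exists j, F `<=` slab_facet j.
Proof. by apply: face_sub_hface; apply/card_gt0P; exists (ord0, true). Qed.

(** The criterion does not involve [alpha] and [beta], which is why both polytopes have the same
    dual graph. *)
Lemma dual_adj_slab i j :
  dual_adj slab (slab_facet i) (slab_facet j) <-> i.1 != j.1.
Proof.
split=> [adj|ij].
  apply/eqP => ij; case: (adj) => ne _; move: adj.
  apply: (not_dual_adj_hpoly (p := 0)); [exact: ltnW|exact: dim_slab|].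
  by apply: slab_opposite_facets => //; apply: contra_notN ne => /eqP ->.
apply: dual_adj_hpoly; [exact: dim_slab| |exact: dim_slab_ridge].
by move/slab_facet_inj => e; rewrite e eqxx in ij.
Qed.

End Slab.

(** * The cube is cubical and not equivalent to the contracted cube *)

Section Cube.
Context {R : realFieldType} {n : nat}.

Lemma slab_height10 (t : 'I_n.+1 -> R) k : slab_height 1 0 t k = 1.
Proof. by rewrite /slab_height mul0r addr0 if_same. Qed.

Lemma unit_cube_slab : @unit_cube R n.+1 = slab 1 0.
Proof.
apply/seteqP; split=> x Px; first by apply/slabP => k; rewrite slab_height10.
by move=> k; move/slabP/(_ k): Px; rewrite slab_height10.
Qed.

Lemma is_cubical_unit_cube : (2 < n)%N -> is_cubical (@unit_cube R n.+1).
Proof.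
move=> n2 F; rewrite unit_cube_slab (facets_slab ler01 (lexx 0) _ n2) ?addr0 //.
move=> [[k c] _ <-]; exists n.
have FE (x : 'rV[R]_n.+1) : slab_facet 1 0 (k, c) x <-> unit_cube x /\ x 0 k = c%:R.
  rewrite unit_cube_slab slab_facetP /slack slab_height10 /=.
  split=> -[Px xk]; split=> //; last by case: c xk => ->; rewrite ?subrr.
  by case: c xk => // /eqP; rewrite subr_eq0 => /eqP.
(* [phi] deletes the constant coordinate [k] of the facet, and [psi] reinserts its value [c]. *)
pose phi (x : 'rV[R]_n.+1) : 'rV[R]_n := \row_l x 0 (lift k l).
pose psi (y : 'rV[R]_n) : 'rV[R]_n.+1 :=
  \row_l if unlift k l is Some m then y 0 m else c%:R.
apply: (comb_equiv_affine (phi := phi) (psi := psi)).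
- by move=> x /FE[Px _] l; rewrite mxE.
- move=> y Py; apply/FE; split=> [l|]; rewrite mxE ?unlift_none //.
  by case: unlift => [m|]; [exact: Py|case: (c); rewrite lexx ler01].
- move=> x /FE[_ xk]; apply/rowP => l; rewrite mxE.
  by case: unliftP => [m ->|->]; rewrite ?mxE.
- by move=> y _; apply/rowP => l; rewrite !mxE liftK.
- move=> a; exists (\row_l if unlift k l is Some m then a 0 m else 0), 0 => x.
  rewrite addr0 /dot [RHS](bigD1_ord k) //= mxE unlift_none mul0r add0r.
  by apply: eq_bigr => l _; rewrite !mxE liftK.
- move=> a; exists (phi a), (a 0 k * c%:R) => y.
  rewrite /dot (bigD1_ord k) //= mxE unlift_none addrC; congr (_ + _).
  by apply: eq_bigr => l _; rewrite !mxE liftK.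
Qed.

(* In the second polytope the origin lies on [n.+2] facets: all the [x_k = 0]
   and the facet opposite to [x_0 = 0]. The corresponding faces of the cube are
   proper and share a point, so by pigeonhole two of them lie on the same facet,
   whose image would be a proper face lying over two distinct facets. *)
Lemma slab_not_comb_equiv : (2 < n)%N ->
  ~ comb_equiv (slab 1 0 : set 'rV[R]_n.+1) (slab 0 1 : set 'rV[R]_n.+1).
Proof.
move=> n2 [f [[fP finj fsurj] fmono]].
set P := slab 1 0 in fP finj fsurj fmono; set P' := slab 0 1 in fP finj fsurj fmono.
have pos1 : 0 < 1 + 0 :> R by rewrite addr0.
have pos2 : 0 < 0 + 1 :> R by rewrite add0r.
have face_sub (Q F : set 'rV[R]_n.+1) : faces Q F -> F `<=` Q.
  by move=> [a [b [_ ->]]] x [].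
have face_top (Q : set 'rV[R]_n.+1) : faces Q Q.
  exists 0, 0; split=> [x _|]; first by rewrite dot0l.
  by apply/seteqP; split=> [x Qx|x []//]; split; rewrite //= dot0l.
have face_bot (Q : set 'rV[R]_n.+1) : faces Q set0.
  exists 0, 1; split=> [x _|]; first by rewrite dot0l.
  by apply/seteqP; split=> // x [_ /=]; rewrite dot0l => /eqP; rewrite eq_sym oner_eq0.
(* An order isomorphism preserves the greatest face, so [f] maps proper faces to proper faces. *)
have ftop F : faces P F -> (P `<=` F <-> P' `<=` f F).
  move=> FP; split=> [PF|PF]; last first.
    apply/(fmono _ _ (face_top P) FP); apply: (subset_trans _ PF).
    by apply: face_sub; apply: fP; exact: face_top.
  have [T TP <-] := fsurj _ (face_top P').
  by apply: (fmono _ _ TP FP).1; apply: (subset_trans _ PF); exact: face_sub.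
(* Otherwise facet [j] would contain its opposite facet. *)
have facet_proper alpha beta (j : 'I_n.+1 * bool) : 0 <= alpha -> 0 <= beta ->
    0 < alpha + beta -> ~ slab alpha beta `<=` slab_facet (R := R) alpha beta j.
  move=> a0 b0 ab sub; have : (j.1, ~~ j.2) = j.
    apply: (slab_facet_inclusion a0 b0 ab n2).
    by apply: (subset_trans _ sub) => x [].
  by case: (j) => k [].
have origin k c : (c = false \/ k = ord0) -> slab_facet 0 1 (k, c) (0 : 'rV[R]_n.+1).
  move=> kc; have h : 0 <= slab_height 0 1 ((0 : 'rV[R]_n.+1) 0) k.
    by apply: slab_height_ge0 => // l; rewrite mxE.
  apply/slab_facetP; split.
    by apply/slabP => l; rewrite mxE lexx slab_height_ge0 // => m; rewrite mxE.
  case: kc => ->; rewrite /slack /= mxE //; case: c => //.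
  by rewrite /slab_height eqxx big1 ?mulr0 ?addr0 ?subr0 // => l _; rewrite mxE.
pose v (o : option 'I_n.+1) := if o is Some k then (k, false) else (@ord0 n, true).
have v0 o : slab_facet 0 1 (v o) (0 : 'rV[R]_n.+1).
  by apply: origin; case: o => [k|]; [left|right].
have [X XP fX] : exists2 X, faces P X & f X = [set 0].
  apply: fsurj; rewrite (_ : [set 0] =
      slab_facet 0 1 (ord0, false) `&` slab_facet 0 1 (ord0, true)).
    by apply: faces_setI; exact: faces_hface.
  apply/seteqP; split=> [_ ->|]; first by split; apply: origin; [left|right].
  exact: slab_opposite_facets.
(* An empty [X] would lie in the preimage of the empty face, putting the origin in the empty set. *)
have [x Xx] : exists x, X x.
  apply/set0P/eqP => X0; have [Z ZP fZ] := fsurj _ (face_bot P').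
  have : f X `<=` f Z by apply: (fmono _ _ XP ZP).1; rewrite X0.
  by rewrite fX fZ => /(_ 0); apply.
have /choice[G GP] : forall o, exists G, faces P G /\ f G = slab_facet 0 1 (v o).
  move=> o; have [G GP fG] := fsurj _ (faces_hface (slab_normal 1) (slab_bound 0) (v o)).
  by exists G.
have /choice[s sP] : forall o, exists j, G o `<=` slab_facet 1 0 j.
  move=> o; have [GoP fGo] := GP o; apply: slab_proper_face => // GE.
  apply: (@facet_proper 0 1 (v o)) => //; rewrite -fGo; apply/ftop => //.
  by rewrite GE.
have sx o : slab_facet 1 0 (s o) x.
  have [GoP fGo] := GP o; apply: sP; apply: (_ : X `<=` G o) Xx.
  by apply/(fmono _ _ XP GoP); rewrite fX fGo => _ ->; exact: v0.
(* Pigeonhole: [n.+2] labels [o] against [n.+1] coordinates. *)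
have /injectivePn[o [o' oo' so]] : ~~ injectiveb (fun o => (s o).1).
  by apply/negP => /injectiveP/leq_card; rewrite card_option card_ord ltnn.
(* Opposite facets of the cube are disjoint, so two facets through [x] with the same coordinate are
   equal. *)
have {}so : s o = s o'.
  apply/eqP; apply: contrapT => /negP ne.
  move: ne so (sx o) (sx o'); case: (s o) (s o') => k c [k' c'] /= ne kk.
  rewrite -{k'}kk in ne *; move=> /slab_facetP[_ +] /slab_facetP[_].
  rewrite /slack slab_height10 /=.
  by case: c c' ne => [] []; rewrite ?eqxx // => _; lra.
have sP' i : faces P (slab_facet 1 0 i) by exact: faces_hface.
have [||j fj] := @slab_proper_face _ _ 0 1 (f (slab_facet 1 0 (s o))).
- by apply: fP.
- move=> fE; apply: (@facet_proper 1 0 (s o)) => //.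
  by apply/(ftop _ (sP' _)); rewrite fE.
have vj i : s i = s o -> v i = j.
  move=> si; apply: (slab_facet_inclusion (lexx 0) ler01 pos2 n2).
  apply: (subset_trans _ fj); have [GiP <-] := GP i.
  by apply: (fmono _ _ GiP (sP' _)).1; rewrite -si; exact: sP.
have := vj o erefl; rewrite -(vj o' (esym so)).
by case: (o) (o') oo' => [k|] [k'|] //= kk' [kE]; rewrite kE eqxx in kk'.
Qed.

End Cube.

Theorem proposition2 (R : realType) :
  exists (d N N' : nat) (P : set 'rV[R]_N) (P' : set 'rV[R]_N'),
    (0 < d)%N /\
    is_dpolytope d P /\ is_cubical P /\
    is_dpolytope d P' /\
    dual_graph_iso P P' /\
    ~ comb_equiv P P'.
Proof.
have pos1 : 0 < 1 + 0 :> R by rewrite addr0.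
have pos2 : 0 < 0 + 1 :> R by rewrite add0r.
have n2 : (2 < 3)%N by [].
(* Dimension 4 is [n.+1] for [n = 3], the least value with [2 < n]. *)
exists 4, 4, 4, (slab 1 0), (slab 0 1).
split=> //; split; first by split; [exact: slab_polytope|exact: dim_slab].
split; first by rewrite -unit_cube_slab; exact: is_cubical_unit_cube.
split; first by split; [exact: slab_polytope|exact: dim_slab].
split; last exact: slab_not_comb_equiv.
apply: (dual_graph_iso_indexed (F := slab_facet 1 0) (F' := slab_facet 0 1)).
- exact: facets_slab.
- exact: facets_slab.
- exact: slab_facet_inj.
- exact: slab_facet_inj.
- by move=> i j; rewrite !dual_adj_slab.
Qed.
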